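(* Let $X$, $Y$ be graphs and let $\varphi:X\rightarrow Y$ be a locally surjective homomorphism. (i) If $C\in\mathcal{C}(X)$, then $\varphi(C)\in\mathcal{C}(Y)$. In particular, the image $\varphi(X)$ of $X$ is a union of components of $Y$. (ii) For every $x\in V_X$, $\varphi(C_X(x))=C_Y(\varphi(x))\cong C_X(x)/\!\sim_{\varphi}$. (iii) For every $C\in\mathcal{C}(X)$, $\varphi^{-1}(\varphi(V_C))=\bigcup_{\hat{C}\in\mathcal{C}(X)_{\varphi(C)}}V_{\hat{C}}$. (iv) For $1\leq i\leq c(Y)$, let $y_i\in V_Y$ be such that $\mathcal{C}(Y)=\{C_Y(y_i):1\leq i\leq c(Y)\}$. Then $$c(X)=\sum_{i=1}^{c(Y)}c(X)_{y_i}.$$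
   Context: All graphs are finite, undirected, simple and reflexive: a graph $X=(V_X,E_X)$ has a finite nonempty vertex set $V_X$, and $E_X$ consists of all loops $\{x\}$ ($x\in V_X$; written $\{x,x\}$) together with a (possibly empty) set of $2$-element subsets of $V_X$ (proper edges). A homomorphism $\varphi:X\to Y$ is a map $\varphi:V_X\to V_Y$ such that $\{x_1,x_2\}\in E_X$ implies $\{\varphi(x_1),\varphi(x_2)\}\in E_Y$ (a proper edge may be mapped to a loop); it induces a map $E_X\to E_Y$. For a subgraph $\hat X\subseteq X$, $\varphi(\hat X)$ is the subgraph of $Y$ with vertex set $\varphi(V_{\hat X})$ and edge set $\varphi(E_{\hat X})$. The neighbourhood of $x$ is $N_X(x)=\{u\in V_X:\{x,u\}\in E_X\}$ (so $x\in N_X(x)$). $\varphi$ is locally surjective if $\varphi(N_X(x))=N_Y(\varphi(x))$ for every $x\in V_X$ ($\varphi$ need not be surjective). $\cong$ denotes graph isomorphism (a bijective homomorphism that maps edges onto edges). A component of $X$ is a maximal connected subgraph (equivalently, the subgraph induced on a connectedness class); $C_X(x)$ is the component containing $x$, $\mathcal{C}(X)$ the set of components, $c(X)=|\mathcal{C}(X)|$. For $C'\in\mathcal{C}(Y)$, $\mathcal{C}(X)_{C'}=\{C\in\mathcal{C}(X):\varphi(C)\subseteq C'\}$, where $\subseteq$ means subgraph. For $y\in V_Y$ and a subgraph $\hat X$ of $X$, $k_{\hat X}(y)=|V_{\hat X}\cap\varphi^{-1}(y)|$; $\mathcal{C}(X)_y=\{C\in\mathcal{C}(X):k_C(y)>0\}$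 and $c(X)_y=|\mathcal{C}(X)_y|$. $\sim_\varphi$ is the equivalence relation on $V_X$ given by $x\sim_\varphi x'$ iff $\varphi(x)=\varphi(x')$. For a graph $Z$ and an equivalence relation $\sim$ on $V_Z$, the quotient graph $Z/\!\sim$ has as vertices the equivalence classes $[z]$, and $\{[z_1],[z_2]\}$ is an edge iff there are $\tilde z_1\sim z_1$, $\tilde z_2\sim z_2$ with $\{\tilde z_1,\tilde z_2\}\in E_Z$. $C_X(x)/\!\sim_\varphi$ is the quotient of the graph $C_X(x)$ by the restriction of $\sim_\varphi$ to its vertices. *)

(* Defs.v *)
From HB Require Import structures.
From mathcomp Require Import all_boot.
From mathcomp Require Import generic_quotient.

Set Implicit Arguments.
Unset Strict Implicit.
Unset Printing Implicit Defensive.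

(* MathComp world. *)

(* A finite nonempty reflexive graph is given by a vertex set and an edge set
   inside an ambient finType: an edge is the set of its endpoints, so {x,y} is
   [set x; y], and a loop {x,x} is the singleton [set x].  Carrying an explicit
   vertex set lets graphs, subgraphs, images, components and quotients all be
   objects of the same kind, and makes graph equality the equality of vertex
   and edge sets. *)
Definition is_graph (T : finType) (G : {set T} * {set {set T}}) : bool :=
  [&& G.1 != set0,
      [forall x in G.1, [set x] \in G.2] &
      [forall e in G.2, (e \subset G.1) && ((#|e| == 1) || (#|e| == 2))]].

Record graph (T : finType) : Type := Graph {
  graph_val : {set T} * {set {set T}};
  graph_valP : is_graph graph_val
}.

HB.instance Definition _ (T : finType) := [isSub for @graph_val T].
HB.instance Definition _ (T : finType) := [Finite of graph T by <:].

Definition vertices (T : finType) (G : graph T) : {set T} := (graph_val G).1.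
Definition edges (T : finType) (G : graph T) : {set {set T}} :=
  (graph_val G).2.

Section GraphBasics.
Variables (T : finType) (G : graph T).

Lemma graph_eqP (H : graph T) :
  vertices G = vertices H -> edges G = edges H -> G = H.
Proof.
rewrite /vertices /edges => e1 e2; apply: val_inj => /=.
by case: (graph_val G) (graph_val H) e1 e2 => [a b] [c d] /= -> ->.
Qed.

Lemma vertices_neq0 : vertices G != set0.
Proof. by have /and3P[] := graph_valP G. Qed.

Lemma edges_loop x : x \in vertices G -> [set x] \in edges G.
Proof. by have /and3P[_ /forall_inP h _] := graph_valP G => /h. Qed.

Lemma edges_sub e : e \in edges G -> e \subset vertices G.
Proof. by have /and3P[_ _ /forall_inP h] := graph_valP G => /h/andP[]. Qed.

Lemma edges_card e : e \in edges G -> (#|e| == 1) || (#|e| == 2).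
Proof. by have /and3P[_ _ /forall_inP h] := graph_valP G => /h/andP[]. Qed.

Lemma edges_pair e : e \in edges G ->
  exists x y, [/\ x \in vertices G, y \in vertices G & e = [set x; y]].
Proof.
move=> eG; have /subsetP sub := edges_sub eG.
have /orP[/cards1P[x ex]|/cards2P[x [y [_ ex]]]] := edges_card eG.
  by exists x, x; rewrite setUid -ex; split=> //; apply: sub; rewrite ex set11.
by exists x, y; split=> //; apply: sub; rewrite ex !inE eqxx ?orbT.
Qed.

End GraphBasics.

Lemma edge_pair_card (T : finType) (x y : T) :
  (#|[set x; y]| == 1) || (#|[set x; y]| == 2).
Proof. by rewrite cards2; case: (x != y). Qed.

Definition subgraph (T : finType) (G H : graph T) : bool :=
  (vertices G \subset vertices H) && (edges G \subset edges H).

(* The underlying map is defined on the whole ambient type; its values outside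
   the vertex set of X play no role in what follows. *)
Definition homomorphism (T U : finType) (X : graph T) (Y : graph U)
    (phi : T -> U) : Prop :=
  (forall x, x \in vertices X -> phi x \in vertices Y) /\
  (forall x1 x2, [set x1; x2] \in edges X ->
     [set phi x1; phi x2] \in edges Y).

Section Image.
Variables (T U : finType) (phi : T -> U) (G : graph T).

Lemma image_is_graph :
  is_graph (phi @: vertices G, [set phi @: e | e : {set T} in edges G]).
Proof.
apply/and3P; split=> /=.
- have /set0Pn[x xG] := vertices_neq0 G.
  by apply/set0Pn; exists (phi x); apply: imset_f.
- apply/forall_inP => y /imsetP[x xG ->]; rewrite -imset_set1.
  by apply: imset_f; apply: edges_loop.
- apply/forall_inP => f /imsetP[e eG ->].
  have [x [y [xG yG ->]]] := edges_pair eG.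
  rewrite imsetU !imset_set1 edge_pair_card andbT.
  by apply/subsetP => z /set2P[] ->; apply: imset_f.
Qed.

Definition image_graph : graph U := Graph image_is_graph.

End Image.

Definition neighbourhood (T : finType) (X : graph T) (x : T) : {set T} :=
  [set u in vertices X | [set x; u] \in edges X].

Definition locally_surjective (T U : finType) (X : graph T) (Y : graph U)
    (phi : T -> U) : Prop :=
  forall x, x \in vertices X ->
    phi @: neighbourhood X x = neighbourhood Y (phi x).

Definition isomorphic (T U : finType) (G : graph T) (H : graph U) : Prop :=
  exists f : T -> U,
    [/\ homomorphism G H f,
        {in vertices G &, injective f},
        f @: vertices G = vertices H &
        [set f @: e | e : {set T} in edges G] = edges H].

Definition adjacent (T : finType) (X : graph T) : rel T :=
  fun u v => [set u; v] \in edges X.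

Definition connected (T : finType) (X : graph T) : bool :=
  [forall x in vertices X, forall y in vertices X, connect (adjacent X) x y].

Definition is_component (T : finType) (X C : graph T) : bool :=
  [&& subgraph C X, connected C &
      [forall D : graph T,
         [&& subgraph D X, connected D & subgraph C D] ==> (D == C)]].

Definition components (T : finType) (X : graph T) : {set graph T} :=
  [set C | is_component X C].

Definition num_components (T : finType) (X : graph T) : nat :=
  #|components X|.

(* For a vertex x of X there is exactly one component containing x (see
   [componentE] below); the default value X is never used then. *)
Definition component (T : finType) (X : graph T) (x : T) : graph T :=
  odflt X [pick C in components X | x \in vertices C].

Section ComponentTheory.
Variables (T : finType) (X : graph T).

Lemma adjacent_sym : symmetric (adjacent X).
Proof. by move=> u v; rewrite /adjacent setUC. Qed.

Lemma adjacent_vertices u v :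
  adjacent X u v -> (u \in vertices X) && (v \in vertices X).
Proof. by move=> /edges_sub; rewrite subUset !sub1set. Qed.

Let cls x := [set u | connect (adjacent X) x u].

Lemma connect_class_sub x : x \in vertices X -> cls x \subset vertices X.
Proof.
move=> xX; apply/subsetP => u; rewrite inE => /connectP[p].
elim: p x xX => [|y p IH] x xX /=; first by move=> _ ->.
by case/andP=> /adjacent_vertices/andP[_ yX] /(IH _ yX).
Qed.

Section Class.
Variables (x : T) (xX : x \in vertices X).

Lemma connect_class_is_graph :
  is_graph (cls x, [set e in edges X | e \subset cls x]).
Proof.
apply/and3P; split=> /=.
- by apply/set0Pn; exists x; rewrite inE connect0.
- apply/forall_inP => u ux; rewrite inE sub1set ux andbT.
  by apply: edges_loop; apply: (subsetP (connect_class_sub xX)).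
- apply/forall_inP => e; rewrite inE => /andP[eX ->].
  exact: edges_card eX.
Qed.

Let K := Graph connect_class_is_graph.

Let K_sub : subgraph K X.
Proof.
rewrite /subgraph connect_class_sub //=.
by apply/subsetP => e; rewrite inE => /andP[].
Qed.

Let K_connected : connected K.
Proof.
have symK : connect_sym (adjacent K).
  by apply: sym_connect_sym => u v; rewrite /adjacent setUC.
have xK y : y \in cls x -> connect (adjacent K) x y.
  rewrite inE => /connectP[p pP ->].
  elim/last_ind: p pP => [|p z IH] /=; first by rewrite connect0.
  rewrite rcons_path last_rcons => /andP[pP adj].
  apply: connect_trans (IH pP) _; apply: connect1.
  have lx : connect (adjacent X) x (last x p) by apply/connectP; exists p.
  rewrite /adjacent inE [_ \in edges X]adj /= subUset !sub1set !inE lx /=.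
  exact: connect_trans lx (connect1 adj).
apply/forall_inP => y yK; apply/forall_inP => z zK.
by apply: connect_trans (xK _ zK); rewrite symK; apply: xK.
Qed.

Let K_max (D : graph T) :
  subgraph D X -> connected D -> x \in vertices D -> subgraph D K.
Proof.
case/andP=> sV /subsetP sE /forall_inP cD xD.
have DK : vertices D \subset cls x.
  apply/subsetP => y yD; rewrite inE.
  have /forall_inP/(_ y yD) := cD x xD.
  by apply: connect_sub => u v uv; apply: connect1; apply: sE.
rewrite /subgraph DK; apply/subsetP => e eD; rewrite inE sE //=.
exact: subset_trans (edges_sub eD) DK.
Qed.

Lemma componentE (C : graph T) :
  (C \in components X) && (x \in vertices C) = (C == component X x).
Proof.
have xK : x \in vertices K by rewrite inE connect0.
have KC : K \in components X.
  rewrite inE /is_component K_sub K_connected /=.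
  apply/forallP => D; apply/implyP => /and3P[sD cD sKD].
  have /(K_max sD cD)/andP[sV sE] : x \in vertices D.
    by case/andP: sKD => /subsetP ->.
  have /andP[sV' sE'] := sKD; apply/eqP/graph_eqP.
    by apply/eqP; rewrite eqEsubset sV sV'.
  by apply/eqP; rewrite eqEsubset sE sE'.
have uniqK D : D \in components X -> x \in vertices D -> D = K.
  rewrite inE => /and3P[sD cD /forallP/(_ K)].
  by rewrite K_sub K_connected /= => h xD; rewrite (eqP (implyP h _)) // K_max.
rewrite /component; case: pickP => [D /andP[DC xD]|/(_ K)]; last first.
  by rewrite KC xK.
rewrite /= (uniqK D) //; apply/andP/eqP => [[CC xC]|->//].
exact: uniqK.
Qed.

Lemma component_vertices :
  vertices (component X x) = [set u | connect (adjacent X) x u].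
Proof.
suff -> : component X x = K by [].
have := componentE (component X x); rewrite eqxx => /andP[].
rewrite inE => /and3P[sD cD /forallP/(_ K)].
by rewrite K_sub K_connected /= => h xD; rewrite -(eqP (implyP h _)) // K_max.
Qed.

End Class.
End ComponentTheory.

(* C(X)_{C'}: the components of X that phi maps into the subgraph C' of Y. *)
Definition components_over (T U : finType) (X : graph T) (phi : T -> U)
    (C' : graph U) : {set graph T} :=
  [set C in components X | subgraph (image_graph phi C) C'].

Definition fibre_count (T U : finType) (phi : T -> U) (G : graph T) (y : U)
    : nat :=
  #|vertices G :&: phi @^-1: [set y]|.

(* c(X)_y: the number of components of X that meet the fibre of phi over y. *)
Definition num_components_at (T U : finType) (X : graph T) (phi : T -> U)
    (y : U) : nat :=
  #|[set C in components X | 0 < fibre_count phi C y]|.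

Section Quotient.
Variables (T : finType) (Z : graph T) (r : equiv_rel T).

Definition quotient_class (z : T) : {set T} := [set u in vertices Z | r z u].

Definition quotient_edges : {set {set {set T}}} :=
  [set [set quotient_class z1; quotient_class z2]
     | z1 in vertices Z, z2 in vertices Z &
       [exists w1 in vertices Z, exists w2 in vertices Z,
          [&& r w1 z1, r w2 z2 & [set w1; w2] \in edges Z]]].

Lemma quotient_is_graph :
  is_graph (quotient_class @: vertices Z, quotient_edges).
Proof.
apply/and3P; split=> /=.
- have /set0Pn[z zZ] := vertices_neq0 Z.
  by apply/set0Pn; exists (quotient_class z); apply: imset_f.
- apply/forall_inP => c /imsetP[z zZ ->].
  apply/imset2P; exists z z; rewrite ?setUid //.
  rewrite inE zZ /=; apply/exists_inP; exists z => //.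
  by apply/exists_inP; exists z => //; rewrite equiv_refl setUid edges_loop.
- apply/forall_inP => e /imset2P[z1 z2 z1Z]; rewrite inE => /andP[z2Z _] ->.
  rewrite edge_pair_card andbT.
  by apply/subsetP => c /set2P[] ->; apply: imset_f.
Qed.

Definition quotient_graph : graph {set T} := Graph quotient_is_graph.

End Quotient.

Section Kernel.
Variables (T U : finType) (phi : T -> U).

Definition kernel_rel : rel T := fun x x' => phi x == phi x'.

Lemma kernel_rel_refl : reflexive kernel_rel.
Proof. by move=> x; apply: eqxx. Qed.

Lemma kernel_rel_sym : symmetric kernel_rel.
Proof. by move=> x y; apply: eq_sym. Qed.

Lemma kernel_rel_trans : transitive kernel_rel.
Proof. by move=> y x z /eqP exy /eqP eyz; apply/eqP; rewrite exy. Qed.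

Definition kernel_equiv : equiv_rel T :=
  EquivRel kernel_rel kernel_rel_refl kernel_rel_sym kernel_rel_trans.

End Kernel.

(* Main.v *)
(** Local surjectivity lets a path of [Y] starting at [phi x] be lifted, edge by
    edge, to a path of [X] starting at [x]; homomorphisms push paths forward.
    Hence [phi] maps the connectedness class of [x] onto that of [phi x], and
    lifting one more edge shows that all edges are hit as well. The other parts
    follow by noting that [C |-> phi(C)] is a well-defined map from the
    components of [X] to those of [Y], whose fibres are counted by [c(X)_y]. *)

Require Import Defs.
From mathcomp Require Import all_boot.

Set Implicit Arguments.
Unset Strict Implicit.
Unset Printing Implicit Defensive.

(** * Components as induced subgraphs on connectedness classes *)

Section Components.
Variables (T : finType) (X : graph T).

Lemma component_in x : x \in vertices X -> component X x \in components X.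
Proof.
by move=> xX; have := componentE xX (component X x); rewrite eqxx => /andP[].
Qed.

Lemma mem_component x : x \in vertices X -> x \in vertices (component X x).
Proof. by move=> xX; rewrite component_vertices // inE connect0. Qed.

Lemma components_subgraph C : C \in components X -> subgraph C X.
Proof. by rewrite inE => /and3P[]. Qed.

Lemma components_vertex C x :
  C \in components X -> x \in vertices C -> x \in vertices X.
Proof. by case/components_subgraph/andP => /subsetP sV _ /sV. Qed.

Lemma component_eq C x :
  C \in components X -> x \in vertices C -> C = component X x.
Proof.
move=> CX xC; apply/eqP.
by rewrite -componentE ?CX //; apply: components_vertex xC.
Qed.

Lemma componentsP C :
  reflect (exists2 x, x \in vertices X & C = component X x)
          (C \in components X).
Proof.
apply: (iffP idP) => [CX|[x xX ->]]; last exact: component_in.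
have /set0Pn[x xC] := vertices_neq0 C.
by exists x; [apply: components_vertex xC | apply: component_eq].
Qed.

(** Maximality makes a component an induced subgraph: adding all edges of [X] between its vertices
    keeps it connected, so nothing can have been added. *)
Lemma component_edges x : x \in vertices X ->
  edges (component X x) =
  [set e in edges X | e \subset vertices (component X x)].
Proof.
move=> xX; have := component_in xX.
have := component_vertices xX; set C := component X x => CV.
rewrite inE => /and3P[/andP[sV /subsetP sE] /forall_inP cC /forallP maxC].
(* The subgraph of [X] induced on the connectedness class of [x], to be compared with [C] by
   maximality of [C]. *)
pose D := Graph (connect_class_is_graph xX).
have DV : vertices D = vertices C by rewrite CV.
have sCD : {subset edges C <= edges D}.
  by move=> e eC; rewrite inE sE //= -CV edges_sub.
suff /eqP DC : D == C by rewrite -[in LHS]DC CV.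
apply: (implyP (maxC D)); apply/and3P; split.
- rewrite /subgraph DV sV /=; apply/subsetP => e.
  by rewrite inE => /andP[].
- apply/forall_inP => u; rewrite DV => /cC/forall_inP cu.
  apply/forall_inP => v /cu.
  by apply: connect_sub => a b ab; apply: connect1; apply: sCD.
- by rewrite /subgraph DV subxx; apply/subsetP.
Qed.

Lemma adjacent_component x u v : x \in vertices X ->
  u \in vertices (component X x) -> adjacent X u v ->
  [set u; v] \in edges (component X x).
Proof.
move=> xX; rewrite component_edges // inE component_vertices // inE => xu uv.
rewrite [_ \in edges X]uv subUset !sub1set !inE xu /=.
exact: connect_trans xu (connect1 uv).
Qed.

End Components.

(** * Images as quotients by the kernel relation *)

Lemma image_graph_isomorphic (T U : finType) (phi : T -> U) (G : graph T) :
  isomorphic (image_graph phi G) (quotient_graph G (kernel_equiv phi)).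
Proof.
(* The isomorphism sends a vertex of the image to its fibre in [G], which is a kernel class; off the
   image the value is the empty set. *)
pose f y := [set u in vertices G | phi u == y].
have fphi z : f (phi z) = quotient_class G (kernel_equiv phi) z.
  by apply/setP => u; rewrite !inE eq_sym.
have fV : f @: vertices (image_graph phi G) =
          vertices (quotient_graph G (kernel_equiv phi)).
  by rewrite /= -imset_comp; apply: eq_imset.
have fpair a b : f @: (phi @: [set a; b]) =
    [set quotient_class G (kernel_equiv phi) a;
         quotient_class G (kernel_equiv phi) b].
  by rewrite !imsetU !imset_set1 !fphi.
have fE : [set f @: e | e : {set U} in edges (image_graph phi G)] =
          edges (quotient_graph G (kernel_equiv phi)).
  apply/setP => c; apply/imsetP/imset2P => [[_ /imsetP[e eG ->] ->]|].
    have [a [b [aG bG ee]]] := edges_pair eG.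
    exists a b => //; last by rewrite ee fpair.
    rewrite inE bG; apply/exists_inP; exists a => //; apply/exists_inP.
    by exists b; rewrite // !equiv_refl -ee.
  case=> z1 z2 z1G; rewrite inE => /andP[z2G].
  case/exists_inP=> w1 w1G /exists_inP[w2 w2G /and3P[/eqP e1 /eqP e2 wE]] ->.
  (* The representatives [w1], [w2] span a genuine edge of [G], and they have the same images, hence
     the same classes, as [z1] and [z2]. *)
  exists (phi @: [set w1; w2]); first exact: imset_f.
  by rewrite fpair -!fphi e1 e2.
exists f; split=> //.
- split=> [y yG|y1 y2 yE]; first by rewrite -fV imset_f.
  by rewrite -fE -!imset_set1 -imsetU imset_f.
(* Equal fibres share the point [a], which determines the value of [phi] on both. *)
- move=> _ y2 /imsetP[a aG ->] _ /setP/(_ a).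
  by rewrite !inE aG eqxx => /esym/eqP.
Qed.

(** * Lifting along a locally surjective homomorphism, and counting components *)

Section LocallySurjective.
Variables (T U : finType) (X : graph T) (Y : graph U) (phi : T -> U).
Hypotheses (phi_hom : homomorphism X Y phi).
Hypotheses (phi_ls : locally_surjective X Y phi).

Lemma homomorphism_connect u v :
  connect (adjacent X) u v -> connect (adjacent Y) (phi u) (phi v).
Proof.
case/connectP=> p pP ->; elim: p u pP => //= w p IH u /andP[uw /IH].
by apply: connect_trans; apply: connect1; apply: phi_hom.2.
Qed.

(** Local surjectivity at [x], read as edge lifting with prescribed starting point; the path and
    component arguments below rest on this form. *)
Lemma adjacent_lift x v : x \in vertices X -> adjacent Y (phi x) v ->
  exists2 u, adjacent X x u & v = phi u.
Proof.
move=> xX xv; have : v \in neighbourhood Y (phi x).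
  by rewrite inE [_ \in edges Y]xv; case/andP: (adjacent_vertices xv) => _ ->.
by rewrite -phi_ls // => /imsetP[u]; rewrite inE => /andP[_ xu] ->; exists u.
Qed.

Lemma connect_lift x v : x \in vertices X -> connect (adjacent Y) (phi x) v ->
  exists2 u, connect (adjacent X) x u & v = phi u.
Proof.
move=> xX /connectP[p pP ->]; elim: p x xX pP => [|w p IH] x xX /=.
  by exists x.
case/andP=> /(adjacent_lift xX)[u xu ->].
have /andP[_ uX] := adjacent_vertices xu.
case/(IH _ uX)=> t ut ->; exists t => //.
exact: connect_trans (connect1 xu) ut.
Qed.

Lemma image_component x : x \in vertices X ->
  image_graph phi (component X x) = component Y (phi x).
Proof.
move=> xX; have yY := phi_hom.1 _ xX.
have EV : phi @: vertices (component X x) = vertices (component Y (phi x)).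
  rewrite !component_vertices //; apply/setP => v; rewrite inE.
  apply/imsetP/idP => [[u]|/(connect_lift xX)[u xu ->]].
    by rewrite inE => /homomorphism_connect h ->.
  by exists u; rewrite ?inE.
apply: graph_eqP => //=; apply/setP => e; apply/imsetP/idP => [[d dC ->]|eC].
  rewrite component_edges // inE -EV (imsetS _ (edges_sub dC)) andbT.
  have := dC; rewrite component_edges // inE => /andP[dX _].
  have [a [b [_ _ dab]]] := edges_pair dX.
  by move: dX; rewrite dab imsetU !imset_set1; apply: phi_hom.2.
have [a [b [aC _ eab]]] := edges_pair eC.
have /imsetP[u uC au] : a \in phi @: vertices (component X x) by rewrite EV.
have uX := components_vertex (component_in xX) uC.
(* Lifting the edge from a preimage [u] of [a] inside the component keeps the whole lifted edge in
   that component. *)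
have /(adjacent_lift uX)[t ut bt] : adjacent Y (phi u) b.
  by move: eC; rewrite component_edges // eab au inE => /andP[].
exists [set u; t]; first exact: adjacent_component.
by rewrite eab au bt imsetU !imset_set1.
Qed.

Lemma image_in_components C :
  C \in components X -> image_graph phi C \in components Y.
Proof.
case/componentsP=> x xX ->; rewrite image_component //.
by apply: component_in; apply: phi_hom.1.
Qed.

(** Since [phi(C)] is itself a component of [Y], a single common vertex identifies it. *)
Lemma image_eq_component C y : C \in components X -> y \in vertices Y ->
  (image_graph phi C == component Y y) = (y \in phi @: vertices C).
Proof. by move=> CX yY; rewrite -componentE // image_in_components. Qed.

Lemma image_union_components :
  exists S : {set graph U},
    [/\ S \subset components Y,
        vertices (image_graph phi X) = \bigcup_(D in S) vertices D &
        edges (image_graph phi X) = \bigcup_(D in S) edges D].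
Proof.
(* The union is taken over the images of the components of [X]. *)
exists [set image_graph phi C | C in components X]; split.
- by apply/subsetP => _ /imsetP[C CX ->]; apply: image_in_components.
- apply/setP => v; apply/imsetP/bigcupP => [[x xX ->]|].
    exists (image_graph phi (component X x)).
      by rewrite imset_f ?component_in.
    by rewrite imset_f ?mem_component.
  case=> _ /imsetP[C CX ->] /imsetP[x xC ->].
  by exists x => //; apply: components_vertex xC.
- apply/setP => d; apply/imsetP/bigcupP => [[e eX ->]|].
    have [a [b [aX _ eab]]] := edges_pair eX.
    exists (image_graph phi (component X a)).
      by rewrite imset_f ?component_in.
    apply: imset_f; rewrite eab; apply: adjacent_component => //.
      exact: mem_component.
    by rewrite /adjacent -eab.
  case=> _ /imsetP[C CX ->] /imsetP[e eC ->]; exists e => //.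
  by have /andP[_ /subsetP->] := components_subgraph CX.
Qed.

Lemma preimage_image_component C : C \in components X ->
  vertices X :&: phi @^-1: (phi @: vertices C) =
  \bigcup_(D in components_over X phi (image_graph phi C)) vertices D.
Proof.
move=> CX; apply/setP => z; rewrite !inE; apply/andP/bigcupP.
  case=> zX zC; exists (component X z); last exact: mem_component.
  (* Both [C] and the component of [z] are mapped onto the component of [phi z]. *)
  have /eqP-> : image_graph phi C == component Y (phi z).
    by rewrite image_eq_component // phi_hom.1.
  by rewrite inE component_in //= -image_component // /subgraph !subxx.
case=> D; rewrite inE => /andP[DX /andP[/subsetP sV _]] zD.
by split; [apply: components_vertex zD | apply: sV; apply: imset_f].
Qed.

(** Rewrites c(X)_y as the size of a fibre of the map [C |-> phi(C)]: meeting the fibre over [y]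
    means that [phi(C)] contains [y]. *)
Lemma num_components_atE y : y \in vertices Y ->
  num_components_at X phi y =
  #|[set C in components X | image_graph phi C == component Y y]|.
Proof.
move=> yY; apply: eq_card => C; rewrite !inE; apply: andb_id2l => CX.
rewrite image_eq_component ?inE // card_gt0.
apply/set0Pn/imsetP => [[x]|[x xC ->]]; last by exists x; rewrite !inE xC eqxx.
by rewrite !inE => /andP[xC /eqP<-]; exists x.
Qed.

Lemma num_components_sum (y : 'I_(num_components Y) -> U) :
  (forall i, y i \in vertices Y) ->
  components Y = [set component Y (y i) | i : 'I_(num_components Y)] ->
  num_components X =
  \sum_(i < num_components Y) num_components_at X phi (y i).
Proof.
move=> yY EY.
(* The c(Y) indices enumerate all c(Y) components, so by cardinality no component is repeated. *)
have inj : {in predT &, injective (fun i => component Y (y i))}.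
  by apply/imset_injP; rewrite -EY card_ord.
rewrite /num_components -sum1_card.
(* Sorts the components of [X] by their image in [Y]; injectivity then lets the sum over components
   of [Y] be reindexed by [i]. *)
rewrite (partition_big (image_graph phi) (mem (components Y))) /=; last first.
  exact: image_in_components.
rewrite [in LHS]EY big_imset //=; apply: eq_bigr => i _.
rewrite num_components_atE // -sum1_card; apply: eq_bigl => C.
by rewrite !inE.
Qed.

End LocallySurjective.

Theorem theoremA (T U : finType) (X : graph T) (Y : graph U) (phi : T -> U)
    (phi_hom : homomorphism X Y phi)
    (phi_ls : locally_surjective X Y phi) :
  [/\
    (* (i) *)
    (forall C, C \in components X -> image_graph phi C \in components Y) /\
    (exists S : {set graph U},
       [/\ S \subset components Y,
           vertices (image_graph phi X) = \bigcup_(D in S) vertices D &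
           edges (image_graph phi X) = \bigcup_(D in S) edges D]),
    (* (ii) *)
    (forall x, x \in vertices X ->
       image_graph phi (component X x) = component Y (phi x) /\
       isomorphic (component Y (phi x))
         (quotient_graph (component X x) (kernel_equiv phi))),
    (* (iii) *)
    (forall C, C \in components X ->
       vertices X :&: phi @^-1: (phi @: vertices C) =
       \bigcup_(D in components_over X phi (image_graph phi C)) vertices D) &
    (* (iv) *)
    (forall y : 'I_(num_components Y) -> U,
       (forall i, y i \in vertices Y) ->
       components Y = [set component Y (y i) | i : 'I_(num_components Y)] ->
       num_components X =
       \sum_(i < num_components Y) num_components_at X phi (y i))].
Proof.
split; last exact: num_components_sum.
- by split; [apply: image_in_components | apply: image_union_components].
- move=> x xX; rewrite -(image_component phi_hom phi_ls xX).
  by split; last exact: image_graph_isomorphic.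
- exact: preimage_image_component phi_hom phi_ls.
Qed.
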